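(* Let $D$ be a finite set, $\gamma,\gamma_*:D\to\mathbb{R}^d$ maps, and $\lambda_1,\dots,\lambda_n,\lambda_1^*,\dots,\lambda_n^*\in\mathbb{R}^d$. Suppose there are maps $g$ (on $\{\gamma(x):x\in D\}$) and $f$ (on $\{\lambda_1,\dots,\lambda_n\}$) with values in $\mathbb{R}^d$ such that $\gamma_*(x)=g(\gamma(x))$ for all $x\in D$ and $\lambda_i^*=f(\lambda_i)$ for all $i$. Assume that $\{\gamma(x):x\in D\}$ spans $\mathbb{R}^d$, that $\{\lambda_i-\lambda_1:2\le i\le n\}$ spans $\mathbb{R}^d$, and that $\{f(\lambda_i)-f(\lambda_1):2\le i\le n\}$ spans $\mathbb{R}^d$. Suppose that for every $x\in D$ and every $i$ $$\frac{\exp(\langle g(\gamma(x)),f(\lambda_i)\rangle)}{\sum_{j=1}^n\exp(\langle g(\gamma(x)),f(\lambda_j)\rangle)}=\frac{\exp(\langle\gamma(x),\lambda_i\rangle)}{\sum_{j=1}^n\exp(\langle\gamma(x),\lambda_j\rangle)}.$$ Then there exist a unique $A\in\operatorname{GL}(d,\mathbb{R})$ and a unique $c\in\mathbb{R}^d$ such that $\gamma_*(x)=A^{-\top}\gamma(x)$ for all $x\in D$ and $\lambda_i^*=A\lambda_i+c$ for all $i$; equivalently (for the second relation), $\Lambda_*=\Lambda A^\top+\mathbf{1}c^\top$.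
   Context: $\langle\cdot,\cdot\rangle$ is the Euclidean inner product on $\mathbb{R}^d$. $\Lambda,\Lambda_*\in\mathbb{R}^{n\times d}$ are the matrices with rows $\lambda_i^\top$ and $(\lambda_i^* )^\top$, and $\mathbf{1}\in\mathbb{R}^n$ is the all-ones vector. *)

(* Defs.v *)
From mathcomp Require Import all_boot all_order all_algebra.
From mathcomp Require Import reals sequences exp.

Set Implicit Arguments.
Unset Strict Implicit.
Unset Printing Implicit Defensive.

Import Order.TTheory GRing.Theory Num.Theory.
Local Open Scope ring_scope.

Definition inner (R : realType) (d : nat) (u v : 'cV[R]_d) : R :=
  \sum_(k < d) u k 0 * v k 0.

Definition softmax (R : realType) (d n : nat) (u : 'cV[R]_d)
    (lam : 'I_n -> 'cV[R]_d) (i : 'I_n) : R :=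
  expR (inner u (lam i)) / \sum_(j < n) expR (inner u (lam j)).

Definition spans (R : realType) (d : nat) (s : seq 'cV[R]_d) : Prop :=
  <<s>>%VS = fullv.

(* The vectors [lam i - lam 0] over all indices [i] other than the base
   index; having a base index requires at least one vector, whence ['I_n.+1]. *)
Definition differences (R : realType) (d n : nat)
    (lam : 'I_n.+1 -> 'cV[R]_d) : seq 'cV[R]_d :=
  [seq lam i - lam ord0 | i : 'I_n.+1 in predC1 ord0].

Definition row_matrix (R : realType) (d n : nat)
    (lam : 'I_n -> 'cV[R]_d) : 'M[R]_(n, d) :=
  \matrix_(i < n) (lam i)^T.

(* Main.v *)
(* Ratios of softmax values remove the normalizing sums, so injectivity of
   [expR] gives [<g (gamma x), f (lambda i) - f (lambda 0)> =
   <gamma x, lambda i - lambda 0>]; collected into matrices this is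
   [L'^T G' = L^T G], where [L], [L'] and [G] have rank [d]. *)

Require Import Defs.
From mathcomp Require Import all_boot all_order all_algebra.
From mathcomp Require Import reals sequences exp.

Set Implicit Arguments.
Unset Strict Implicit.
Unset Printing Implicit Defensive.

Import Order.TTheory GRing.Theory Num.Theory.
Local Open Scope ring_scope.

(** A row vector [u] with [u *m V = 0] kills every column of [V], hence every vector of [s], hence
    by linearity all of the space. Testing it on the standard basis vectors gives [u = 0]. *)
Lemma row_free_of_spans (R : realType) (d m : nat) (s : seq 'cV[R]_d)
    (V : 'M[R]_(d, m)) :
  spans s -> (forall v, v \in s -> exists j, v = col j V) -> row_free V.
Proof.
move=> s_spans s_col; apply: inj_row_free => u uV0.
suff ker (v : 'cV_d) : u *m v = 0.
  apply/rowP => k; have := ker (delta_mx k 0).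
  by rewrite -colE => /matrixP/(_ 0 0); rewrite !mxE.
have : v \in <<s>>%VS by rewrite s_spans memvf.
move=> /(@coord_span _ _ _ (in_tuple s)) ->; rewrite mulmx_sumr big1 // => i _.
have [j ->] := s_col _ (mem_nth 0 (ltn_ord i)).
by rewrite -scalemxAr colE mulmxA uV0 mul0mx scaler0.
Qed.

(** The base index keeps its column, which is zero: this leaves the rank unchanged and avoids
    reindexing the other vectors. *)
Definition difference_mx (R : realType) (d n : nat)
    (lam : 'I_n.+1 -> 'cV[R]_d) : 'M[R]_(d, n.+1) :=
  \matrix_(k, i) (lam i - lam ord0) k 0.

Lemma col_difference_mx (R : realType) (d n : nat)
    (lam : 'I_n.+1 -> 'cV[R]_d) i :
  col i (difference_mx lam) = lam i - lam ord0.
Proof. by apply/colP => k; rewrite !mxE. Qed.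

Lemma row_free_difference_mx (R : realType) (d n : nat)
    (lam : 'I_n.+1 -> 'cV[R]_d) :
  spans (differences lam) -> row_free (difference_mx lam).
Proof.
move/row_free_of_spans; apply=> _ /imageP[i _ ->].
by exists i; rewrite col_difference_mx.
Qed.

Lemma innerBr (R : realType) (d : nat) (u v w : 'cV[R]_d) :
  inner u (v - w) = inner u v - inner u w.
Proof. by rewrite /inner -sumrB; apply: eq_bigr => k _; rewrite !mxE mulrBr. Qed.

Lemma softmax_ratio (R : realType) (d n : nat) (u : 'cV[R]_d)
    (lam : 'I_n -> 'cV[R]_d) (i j : 'I_n) :
  softmax u lam i / softmax u lam j = expR (inner u (lam i - lam j)).
Proof.
(* The index [i] itself supplies a positive term, so the sum is nonempty and can be cancelled. *)
have sum_gt0 : 0 < \sum_(k < n) expR (inner u (lam k)).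
  rewrite (bigD1 i) //= ltr_pwDl ?expR_gt0 // sumr_ge0 // => k _.
  exact: expR_ge0.
rewrite /softmax innerBr expRD expRN invf_div mulrA divfK //.
exact: lt0r_neq0.
Qed.

Lemma eq_softmax_inner (R : realType) (d n : nat) (u u' : 'cV[R]_d)
    (lam lam' : 'I_n -> 'cV[R]_d) :
  softmax u lam =1 softmax u' lam' ->
  forall i j, inner u (lam i - lam j) = inner u' (lam' i - lam' j).
Proof. by move=> eqs i j; apply: expR_inj; rewrite -!softmax_ratio !eqs. Qed.

Lemma affine_row_matrixE (R : realType) (d n : nat)
    (lam lam' : 'I_n -> 'cV[R]_d) (A : 'M[R]_d) (c : 'cV[R]_d) :
  (forall i, lam' i = A *m lam i + c) <->
  row_matrix lam' = row_matrix lam *m A^T + const_mx 1 *m c^T.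
Proof.
have rowE i : row i (row_matrix lam *m A^T + const_mx 1 *m c^T) =
    (A *m lam i + c)^T.
  rewrite linearD /= !row_mul rowK row_const linearD /= trmx_mul.
  by congr (_ + _); apply/rowP => k; rewrite !mxE big_ord1 !mxE mul1r.
split=> [lamE | matE i].
  by apply/row_matrixP => i; rewrite rowE rowK lamE.
by apply: trmx_inj; rewrite -rowE -matE rowK.
Qed.

(* Matching Gram matrices of two full-rank factorizations determine the change
   of basis: with [W'] a right inverse of [L'],
   the equation reads [G' = B G] for [B = W'^T L^T]. *)
Lemma full_rank_factorization (F : fieldType) (d m p : nat)
    (L L' : 'M[F]_(d, m)) (G G' : 'M[F]_(d, p)) :
  row_free L -> row_free L' -> row_free G -> L'^T *m G' = L^T *m G ->
  exists2 A : 'M[F]_d, A \in unitmx & L' = A *m L /\ G' = (invmx A)^T *m G.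
Proof.
move=> /row_freeP[W LW] /row_freeP[W' LW'] freeG eqLG.
pose B := W'^T *m L^T.
have GE : G' = B *m G.
  by rewrite -mulmxA -eqLG mulmxA -trmx_mul LW' trmx1 mul1mx.
(* Both sides agree after right multiplication by [G], which is cancellable because its rows are
   independent. *)
have LE : L'^T *m B = L^T.
  by apply: (row_free_inj freeG); rewrite -eqLG GE mulmxA.
(* Multiplying [LE] by [W^T] gives [(W^T *m L'^T) *m B = (L *m W)^T = 1], a product of square
   matrices. *)
have [_ unitB] : W^T *m L'^T \in unitmx /\ B \in unitmx.
  by apply: mulmx1_unit; rewrite -mulmxA LE -trmx_mul LW trmx1.
(* This choice makes the inverse transpose of [A] equal to [B]. *)
exists (invmx B)^T; first by rewrite unitmx_tr unitmx_inv.
split; last by rewrite -trmx_inv invmxK trmxK.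
by apply: trmx_inj; rewrite trmx_mul trmxK -LE mulmxK.
Qed.

Theorem propositionB5 (R : realType) (d n : nat) (D : finType)
  (gamma gamma_star : D -> 'cV[R]_d)
  (lambda lambda_star : 'I_n.+1 -> 'cV[R]_d)
  (g f : 'cV[R]_d -> 'cV[R]_d)
  (gamma_starE : forall x, gamma_star x = g (gamma x))
  (lambda_starE : forall i, lambda_star i = f (lambda i))
  (gamma_spans : spans (codom gamma))
  (lambda_spans : spans (differences lambda))
  (f_lambda_spans : spans (differences (fun i => f (lambda i))))
  (same_softmax : forall x i,
    softmax (g (gamma x)) (fun j => f (lambda j)) i = softmax (gamma x) lambda i) :
  (exists! Ac : 'M[R]_d * 'cV[R]_d,
    [/\ Ac.1 \in unitmx,
        forall x, gamma_star x = (invmx Ac.1)^T *m gamma x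
      & forall i, lambda_star i = Ac.1 *m lambda i + Ac.2]) /\
  (forall (A : 'M[R]_d) (c : 'cV[R]_d),
    (forall i, lambda_star i = A *m lambda i + c) <->
    row_matrix lambda_star = row_matrix lambda *m A^T + const_mx 1 *m c^T).
Proof.
split; last by move=> A c; exact: affine_row_matrixE.
pose L := difference_mx lambda.
pose L' := difference_mx (fun i => f (lambda i)).
(* Enumerating [D] turns a family of vectors indexed by [D] into the columns of a matrix. *)
pose columns (v : D -> 'cV[R]_d) := \matrix_(k < d, j < #|D|) v (enum_val j) k 0.
pose G := columns gamma.
pose G' := columns gamma_star.
have col_columns v x : col (enum_rank x) (columns v) = v x.
  by apply/colP => k; rewrite !mxE enum_rankK.
have gramE lam v i j : ((difference_mx lam)^T *m columns v) i j =
    inner (v (enum_val j)) (lam i - lam ord0).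
  rewrite mxE; apply: eq_bigr => k _.
  by rewrite mulrC !mxE.
have freeL : row_free L by exact: row_free_difference_mx.
have freeL' : row_free L' by exact: row_free_difference_mx.
have freeG : row_free G.
  apply: (row_free_of_spans gamma_spans) => _ /codomP[x ->].
  by exists (enum_rank x); rewrite col_columns.
have gram : L'^T *m G' = L^T *m G.
  apply/matrixP => i j; rewrite !gramE gamma_starE.
  exact: (eq_softmax_inner (same_softmax (enum_val j))).
have [A unitA [LE GE]] := full_rank_factorization freeL freeL' freeG gram.
(* The translation is forced by the affine relation at the base index. *)
exists (A, f (lambda ord0) - A *m lambda ord0); split=> [|[A' c'] /= [_ _ lamE]].
  split=> //= [x | i].
    by rewrite -(col_columns gamma_star) -/G' GE colE -mulmxA -colE col_columns.
  rewrite lambda_starE addrCA -mulmxBr -(col_difference_mx lambda) colE mulmxA -colE.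
  by rewrite -LE col_difference_mx addrC subrK.
(* Uniqueness: taking differences cancels [c'], and [L] is right-cancellable, so [A' = A]; the base
   index then determines [c']. *)
have LE' : L' = A' *m L.
  apply/matrixP => k i; move/colP/(_ k): (col_difference_mx (f \o lambda) i).
  rewrite mxE => -> /=; rewrite -!lambda_starE !lamE opprD addrACA subrr addr0 -mulmxBr.
  by rewrite -(col_difference_mx lambda) colE mulmxA -colE mxE.
have AE : A = A' by apply: (row_free_inj freeL); rewrite -LE.
by rewrite AE -lambda_starE lamE addrC addKr.
Qed.
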